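(* Let $M\ge1$ be an integer, let $\lambda>0$, and let the quadrature rule with nodes $\mathbf{x}_1,\dots,\mathbf{x}_N\in\mathbb{S}^d$ and positive weights $w_1,\dots,w_N$ have exactness $2M$. Let $$\mathfrak{I}(\mathbb{S}^d)=\{\mathcal{L}_m:1\le m\le M\}\cup\{\mathcal{H}_m^\lambda:1\le m\le M\}$$ and let $1\le n\le M$. Then the hyperinterpolation operator $\mathcal{L}_n$, acting on $\mathfrak{I}(\mathbb{S}^d)$ by $x\mapsto\mathcal{L}_n(x):=\mathcal{L}_n\circ x$, is a hyper homomorphism on $\mathfrak{I}(\mathbb{S}^d)$; that is, $\mathcal{L}_n$ is a linear operator, the map $x\mapsto\mathcal{L}_n(x)$ is not identically zero, and $$\mathcal{L}_n(xy)=\mathcal{L}_n(x)\,\mathcal{L}_n(y)\qquad\text{for all }x,y\in\mathfrak{I}(\mathbb{S}^d),$$ where products are compositions of operators.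
   Context: Let $d\ge2$ and let $\mathbb{S}^d\subset\mathbb{R}^{d+1}$ be the unit sphere with Lebesgue surface measure $\mathrm{d}\omega_d$. $\mathcal{C}(\mathbb{S}^d)$ is the space of real continuous functions on $\mathbb{S}^d$; $\mathbb{P}_n(\mathbb{S}^d)$ is the space of restrictions to $\mathbb{S}^d$ of real polynomials of total degree at most $n$. For each $\ell\ge0$, $\mathbb{H}_\ell(\mathbb{S}^d)$ is the space of real spherical harmonics of degree $\ell$ (restrictions of real harmonic homogeneous polynomials of degree $\ell$), $Z(d,\ell)=\dim\mathbb{H}_\ell(\mathbb{S}^d)$, and $\{Y^{(d)}_{\ell k}:k=1,\dots,Z(d,\ell)\}$ is a fixed real $L_2(\mathbb{S}^d)$-orthonormal basis of $\mathbb{H}_\ell(\mathbb{S}^d)$. The quadrature rule $\sum_{j=1}^N w_jf(\mathbf{x}_j)$ has exactness $r$ if $\sum_{j=1}^N w_jp(\mathbf{x}_j)=\int_{\mathbb{S}^d}p\,\mathrm{d}\omega_d$ for all $p\in\mathbb{P}_r(\mathbb{S}^d)$. Put $\langle f,g\rangle_N=\sum_{j=1}^N w_jf(\mathbf{x}_j)g(\mathbf{x}_j)$. Hyperinterpolation operator: $\mathcal{L}_mf=\sum_{\ell=0}^m\sum_{k=1}^{Z(d,\ell)}\langle f,Y^{(d)}_{\ell k}\rangle_N Y^{(d)}_{\ell k}$. Hard thresholding hyperinterpolation operator: $\mathcal{H}_m^\lambda f=\sum_{\ell=0}^m\sum_{k=1}^{Z(d,\ell)}\eta_H\big(\langle f,Y^{(d)}_{\ell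 k}\rangle_N,\lambda\big)Y^{(d)}_{\ell k}$, where $\eta_H(a,\lambda)=a$ if $|a|>\lambda$ and $\eta_H(a,\lambda)=0$ if $|a|\le\lambda$. The set $\mathfrak{I}(\mathbb{S}^d)$ is a hyper semigroup: a set $\mathfrak{B}$ of operators from $\mathcal{C}(\mathbb{S}^d)$ to a space $\mathbb{P}_r(\mathbb{S}^d)$ closed under (associative) composition, with $\langle\mathcal{T}f,\mathcal{T}f\rangle_N+\langle\mathcal{T}f-f,\mathcal{T}f-f\rangle_N=\langle f,f\rangle_N$ for all $\mathcal{T}\in\mathfrak{B}$, $f\in\mathcal{C}(\mathbb{S}^d)$. A linear operator $\phi$ on a hyper semigroup $\mathcal{A}$, not identically zero, is a hyper homomorphism if $\phi(xy)=\phi(x)\phi(y)$ for all $x,y\in\mathcal{A}$; linearity here refers to $\mathcal{L}_n$ as an operator on $\mathcal{C}(\mathbb{S}^d)$. *)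

(* Defs.v *)
From HB Require Import structures.
From mathcomp Require Import all_boot all_order all_algebra.
From mathcomp Require Import all_classical all_reals all_analysis.
From mathcomp Require Import measurable_realfun.
From mathcomp Require mpoly.
Import (canonicals, coercions) mpoly.

Set Implicit Arguments.
Unset Strict Implicit.
Unset Printing Implicit Defensive.

Import Order.TTheory GRing.Theory Num.Theory.
Import numFieldNormedType.Exports.

Local Open Scope classical_set_scope.
Local Open Scope ring_scope.

Section continuous_lmodule.
Context {R : realType} {X : topologicalType}.
Local Notation C := (continuousType X R).
Implicit Types (f g h : C) (a b : R).

Let cts0 : continuous (fun _ : X => 0 : R).
Proof. by move=> x; exact: cvg_cst. Qed.
Let ctsN f : continuous (fun x => - f x).
Proof. by move=> x; apply: cvgN; exact: cts_fun. Qed.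
Let ctsD f g : continuous (fun x => f x + g x).
Proof. by move=> x; apply: cvgD; exact: cts_fun. Qed.
Let ctsZ a f : continuous (fun x => a * f x).
Proof. by move=> x; apply: cvgM; [exact: cvg_cst|exact: cts_fun]. Qed.

Definition cts_zero : C := mkcts cts0.
Definition cts_opp f : C := mkcts (@ctsN f).
Definition cts_add f g : C := mkcts (@ctsD f g).
Definition cts_scale a f : C := mkcts (@ctsZ a f).

Let cts_addA : associative cts_add.
Proof. by move=> f g h; apply/continuousEP => x /=; exact: addrA. Qed.
Let cts_addC : commutative cts_add.
Proof. by move=> f g; apply/continuousEP => x /=; exact: addrC. Qed.
Let cts_add0 : left_id cts_zero cts_add.
Proof. by move=> f; apply/continuousEP => x /=; exact: add0r. Qed.
Let cts_addN : left_inverse cts_zero cts_opp cts_add.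
Proof. by move=> f; apply/continuousEP => x /=; exact: addNr. Qed.

HB.instance Definition _ :=
  GRing.isZmodule.Build C cts_addA cts_addC cts_add0 cts_addN.

Let cts_scaleA a b f : cts_scale a (cts_scale b f) = cts_scale (a * b) f.
Proof. by apply/continuousEP => x /=; exact: mulrA. Qed.
Let cts_scale1 : left_id 1 cts_scale.
Proof. by move=> f; apply/continuousEP => x /=; exact: mul1r. Qed.
Let cts_scaleDr : right_distributive cts_scale +%R.
Proof. by move=> a f g; apply/continuousEP => x /=; exact: mulrDr. Qed.
Let cts_scaleDl f : {morph cts_scale^~ f : a b / a + b}.
Proof. by move=> a b; apply/continuousEP => x /=; exact: mulrDl. Qed.

HB.instance Definition _ := GRing.Zmodule_isLmodule.Build R C
  cts_scaleA cts_scale1 cts_scaleDr cts_scaleDl.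

End continuous_lmodule.

Section lebesgue_tuple.
Context {R : realType}.
Local Notation RT := (measurableTypeR R).

Section step.
Variables (n : nat) (mu : {sigma_finite_measure set (n.-tuple RT) -> \bar R}).

Definition cons_pair (xt : RT * n.-tuple RT) : n.+1.-tuple RT :=
  [tuple of xt.1 :: xt.2].

Let measurable_cons_pair : measurable_fun [set: RT * n.-tuple RT] cons_pair.
Proof. exact: (measurable_cons measurable_fst measurable_snd). Qed.

HB.instance Definition _ :=
  isMeasurableFun.Build _ _ _ _ cons_pair measurable_cons_pair.

Definition lebesgue_cons : set (n.+1.-tuple RT) -> \bar R :=
  pushforward (lebesgue_measure \x mu)%E cons_pair.

Let lebesgue_cons0 : lebesgue_cons set0 = 0%E.
Proof. exact: measure0. Qed.
Let lebesgue_cons_ge0 A : (0 <= lebesgue_cons A)%E.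
Proof. exact: measure_ge0. Qed.
Let lebesgue_cons_sigma_additive : semi_sigma_additive lebesgue_cons.
Proof. exact: measure_semi_sigma_additive. Qed.

HB.instance Definition _ := isMeasure.Build _ _ _ lebesgue_cons
  lebesgue_cons0 lebesgue_cons_ge0 lebesgue_cons_sigma_additive.

Let sigma_finite_product : sigma_finite setT (lebesgue_measure \x mu)%E.
Proof.
have /sigma_finiteP[F [TF ndF Foo]] := sigma_finiteT (@lebesgue_measure R).
have /sigma_finiteP[G [TG ndG Goo]] := sigma_finiteT mu.
exists (fun n => F n `*` G n).
  rewrite -setXTT TF TG predeqE => -[x y]; split.
    move=> [/= [k _ Fkx] [l _ Gly]]; exists (maxn k l) => //; split.
    - by move: x Fkx; exact/subsetPset/ndF/leq_maxl.
    - by move: y Gly; exact/subsetPset/ndG/leq_maxr.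
  by move=> [k _ []/= ? ?]; split; exists k.
move=> k; have [? ?] := Foo k; have [? ?] := Goo k.
split; first exact: measurableX.
by rewrite product_measure1E// lte_mul_pinfty// ge0_fin_numE.
Qed.

Let lebesgue_cons_sigma_finite : sigma_finite setT lebesgue_cons.
Proof.
have [F FT mF] := sigma_finite_product.
pose uncons (t : n.+1.-tuple RT) : RT * n.-tuple RT :=
  (tnth t ord0, [tuple of behead t]).
have muncons : measurable_fun setT uncons.
  apply/measurable_fun_pairP; split.
    exact: measurable_tnth.
  exact: measurable_behead.
have consK : cancel cons_pair uncons.
  move=> [x t]; rewrite /uncons /cons_pair /= tnth0; congr pair.
  exact: val_inj.
exists (fun i => uncons @^-1` F i).
  by rewrite -preimage_bigcup -FT preimage_setT.
move=> i; split.
  by rewrite -[X in measurable X]setTI; apply: muncons => //; exact: (mF i).1.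
rewrite /lebesgue_cons /pushforward -comp_preimage.
rewrite (_ : uncons \o cons_pair = id); first exact: (mF i).2.
by apply/funext => x; exact: consK.
Qed.

HB.instance Definition _ :=
  Measure_isSigmaFinite.Build _ _ _ lebesgue_cons lebesgue_cons_sigma_finite.

End step.

(* n-dimensional Lebesgue measure: the n-fold product of [lebesgue_measure]. *)
Fixpoint lebesgue_tuple n : {sigma_finite_measure set (n.-tuple RT) -> \bar R} :=
  match n with
  | 0 => \d_([tuple] : 0.-tuple RT)
  | m.+1 => lebesgue_cons (lebesgue_tuple m)
  end.

End lebesgue_tuple.
Arguments lebesgue_tuple : clear implicits.

Section sphere.
Variables (R : realType) (d : nat).
Local Notation RT := (measurableTypeR R).

Definition sphere : set 'rV[R]_d.+1 := [set x | \sum_i x 0 i ^+ 2 = 1].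

Definition Sphere : Type := sphere.

Definition coord (x : Sphere) (i : 'I_d.+1) : R := set_val x 0 i.

Definition euclid_norm (t : d.+1.-tuple RT) : R :=
  Num.sqrt (\sum_i tnth t i ^+ 2).

(* The value at the origin is irrelevant: it is a Lebesgue-null point, and it is
   excluded from [punctured_ball] below. *)
Definition radial (t : d.+1.-tuple RT) : 'rV[R]_d.+1 :=
  if euclid_norm t == 0 then delta_mx 0 0
  else \row_i (tnth t i / euclid_norm t).

Lemma radial_sphere t : radial t \in sphere.
Proof.
rewrite inE /sphere /radial /=; case: eqVneq => [_|t0].
  rewrite big_ord_recl mxE !eqxx expr1n big1 ?addr0// => i _.
  by rewrite mxE /= expr0n.
under eq_bigr do rewrite mxE expr_div_n.
have s0 : 0 <= \sum_i tnth t i ^+ 2 by apply: sumr_ge0 => i _; exact: sqr_ge0.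
rewrite -mulr_suml sqr_sqrtr// divff//.
by apply: contra t0 => /eqP; rewrite /euclid_norm => ->; rewrite sqrtr0.
Qed.

Definition sphere_proj (t : d.+1.-tuple RT) : Sphere :=
  exist _ (radial t) (radial_sphere t).

HB.instance Definition _ := Topological.copy Sphere (sphere : Type).
HB.instance Definition _ :=
  isPointed.Build Sphere (sphere_proj [tuple 0 | _ < d.+1]).

(* The Borel sigma-algebra of the sphere is the one generated by the
   coordinates. *)
Definition coord_tuple (x : Sphere) : d.+1.-tuple RT :=
  [tuple coord x i | i < d.+1].
HB.instance Definition _ :=
  Measurable.copy Sphere (g_sigma_algebra_preimageType coord_tuple).

Lemma measurable_euclid_norm : measurable_fun setT euclid_norm.
Proof.
apply: (measurableT_comp (continuous_measurable_fun (@sqrt_continuous R))).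
by apply: measurable_sum => i; apply: measurable_funX; exact: measurable_tnth.
Qed.

Let measurable_sphere_proj : measurable_fun setT sphere_proj.
Proof.
have mcoord : measurable_fun setT (coord_tuple \o sphere_proj).
  apply/measurable_fun_tnthP => i.
  rewrite (_ : _ \o _ = fun t => if euclid_norm t == 0
      then (delta_mx 0 0 : 'rV[R]_d.+1) 0 i
      else tnth t i * powR (euclid_norm t) (-1)); last first.
    apply/funext => t; rewrite /= tnth_mktuple /coord set_valE /= /radial.
    by case: ifP => // _; rewrite mxE powR_inv1 ?sqrtr_ge0.
  apply: measurable_fun_ifT.
  - by apply: measurable_fun_eqr => //; exact: measurable_euclid_norm.
  - exact: measurable_cst.
  - apply: measurable_funM; first exact: measurable_tnth.
    exact: (measurableT_comp (measurable_powR _) measurable_euclid_norm).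
by move=> _ _ [C mC <-]; rewrite !setTI -comp_preimage -[X in measurable X]setTI;
  exact: mcoord.
Qed.

HB.instance Definition _ :=
  isMeasurableFun.Build _ _ _ _ sphere_proj measurable_sphere_proj.

Definition punctured_ball : set (d.+1.-tuple RT) :=
  [set t | 0 < euclid_norm t <= 1].

Lemma measurable_punctured_ball : measurable punctured_ball.
Proof.
rewrite (_ : punctured_ball = euclid_norm @^-1` `]0, 1]%classic).
  by rewrite -[X in measurable X]setTI; exact: measurable_euclid_norm.
by apply/seteqP; split=> t; rewrite /punctured_ball /= in_itv.
Qed.

(* [cone_measure A] is the Lebesgue measure of the
   solid cone {r x | x in A, 0 < r <= 1}. *)
Definition cone_measure : set Sphere -> \bar R :=
  pushforward (mrestr (lebesgue_tuple R d.+1) measurable_punctured_ball)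
    sphere_proj.

Let cone_measure0 : cone_measure set0 = 0%E.
Proof. exact: measure0. Qed.
Let cone_measure_ge0 A : (0 <= cone_measure A)%E.
Proof. exact: measure_ge0. Qed.
Let cone_measure_sigma_additive : semi_sigma_additive cone_measure.
Proof. exact: measure_semi_sigma_additive. Qed.

HB.instance Definition _ := isMeasure.Build _ _ _ cone_measure
  cone_measure0 cone_measure_ge0 cone_measure_sigma_additive.

(* In R^(d+1), integration in polar coordinates gives the solid cone over [A]
   the volume \int_0^1 r^d dr = 1 / (d + 1) times the surface area of [A]. *)
Definition surface_measure : set Sphere -> \bar R :=
  mscale d.+1%:R%:nng cone_measure.

HB.instance Definition _ := Measure.on surface_measure.

End sphere.
Arguments surface_measure : clear implicits.

Section harmonics.
Context {R : realType} {d : nat}.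
Local Notation C := (continuousType (Sphere R d) R).
Local Notation polynomial := (mpoly.mpoly d.+1 R).

Definition restrict_poly (p : polynomial) (x : Sphere R d) : R :=
  mpoly.meval (coord x) p.

Definition laplacian (p : polynomial) : polynomial :=
  \sum_(i < d.+1) mpoly.mderiv i (mpoly.mderiv i p).

(* [mpoly.msize p] is one more than the total degree of [p]. *)
Definition poly_space (n : nat) : set C :=
  [set f : C | exists2 p : polynomial,
     (mpoly.msize p <= n.+1)%N & forall x, f x = restrict_poly p x].

Definition harmonic_space (l : nat) : set C :=
  [set f : C | exists p : polynomial,
     [/\ p \is mpoly.ishomog1 l mpoly.mdeg, laplacian p = 0
       & forall x, f x = restrict_poly p x]].

Definition L2_dot (f g : C) : R := \int[surface_measure R d]_x (f x * g x).

(* Orthonormality makes [Y] free, so [m] is the dimension of [V]. *)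
Definition orthonormal_basis (V : set C) (m : nat) (Y : 'I_m -> C) :=
  [/\ forall k, V (Y k),
      forall j k, L2_dot (Y j) (Y k) = (j == k)%:R
    & forall f, V f -> exists c : 'I_m -> R, f = \sum_(k < m) c k *: Y k].

End harmonics.

Section quadrature.
Context {R : realType} {d N : nat}.
Local Notation C := (continuousType (Sphere R d) R).
Variables (w : 'I_N -> R) (x : 'I_N -> Sphere R d).

Definition quadrature (f : C) : R := \sum_(j < N) w j * f (x j).

Definition quadrature_exactness (r : nat) :=
  forall p : C, poly_space r p ->
    quadrature p = \int[surface_measure R d]_y p y.

Definition discrete_dot (f g : C) : R :=
  \sum_(j < N) w j * f (x j) * g (x j).

Section operators.
Variables (Z : nat -> nat) (Y : forall l, 'I_(Z l) -> C).

Definition hyperinterpolation (m : nat) (f : C) : C :=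
  \sum_(l < m.+1) \sum_(k < Z l) discrete_dot f (Y k) *: Y k.

Definition hard_threshold (a lambda : R) : R :=
  if `|a| > lambda then a else 0.

Definition hard_hyperinterpolation (lambda : R) (m : nat) (f : C) : C :=
  \sum_(l < m.+1) \sum_(k < Z l)
    hard_threshold (discrete_dot f (Y k)) lambda *: Y k.

Definition hyper_operators (lambda : R) (M : nat) : set (C -> C) :=
  [set hyperinterpolation m | m in [set m | (1 <= m <= M)%N]] `|`
  [set hard_hyperinterpolation lambda m | m in [set m | (1 <= m <= M)%N]].

End operators.

Definition hyper_semigroup (B : set (C -> C)) :=
  [/\ exists r, forall T f, B T -> poly_space r (T f),
      forall S T, B S -> B T -> B (S \o T)
    & forall T f, B T ->
        discrete_dot (T f) (T f) + discrete_dot (T f - f) (T f - f)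
        = discrete_dot f f].

(* [phi] acts on the hyper semigroup [B] by [T |-> phi \o T]. *)
Definition hyper_homomorphism (B : set (C -> C)) (phi : C -> C) :=
  [/\ hyper_semigroup B,
      linear phi,
      exists2 T, B T & phi \o T <> (fun=> 0)
    & forall S T, B S -> B T -> phi \o (S \o T) = (phi \o S) \o (phi \o T)].

End quadrature.

(* Main.v *)
Require Import Defs.
From HB Require Import structures.
From mathcomp Require Import all_boot all_order all_algebra.
From mathcomp Require Import all_classical all_reals all_analysis.
From mathcomp Require Import measurable_realfun ring lra.
From mathcomp Require mpoly.
Import (canonicals, coercions) mpoly.
Import Order.TTheory GRing.Theory Num.Theory.
Import numFieldNormedType.Exports.

(** Hyperinterpolation and hard thresholding both act on the discrete
    coefficients of a function in the basis of spherical harmonics: they keep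
    the degrees up to [m] and apply to each coefficient a function [eta], the
    identity or the threshold, that keeps it or replaces it by zero
    ([thresholded]). If the basis functions of degree at most [M] are
    orthonormal for the discrete product, such an operator returns an expansion
    whose discrete coefficients are the ones just computed
    ([coefficient_expansion]). Hence operators compose by composing the [eta]
    and taking the smaller degree ([thresholded_comp]); as the identity and the
    threshold are closed under composition, so is the family of operators, and
    inserting [L_n] once more between two operators followed by [L_n] changes
    nothing. The Pythagorean identity holds since [eta a * eta a = eta a * a].

    Discrete orthonormality comes from exactness: a product of two harmonics of
    degree at most [M] has degree at most [2 * M], so its discrete and its
    continuous inner product agree. Within one degree the basis is orthonormal
    by assumption. What remains is that harmonics of different degrees are
    orthogonal for the surface measure, here defined from the Lebesgue measure
    of solid cones ([sphere_integral_harmonic]).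

    Polar coordinates and the divergence theorem on the ball are avoided by
    using only rotation invariance. A plane rotation is a product of three
    shears, and a shear preserves Lebesgue measure by Fubini and translation
    invariance, so rotations preserve the surface measure
    ([surface_measure_rot]). Differentiating along rotations shows that the
    integral over the sphere of [x_i * d_j p - x_j * d_i p] is zero for every
    polynomial [p] ([sphere_integral_angular]). Since the squared norm is [1] on
    the sphere, these relations give a divergence theorem
    ([sphere_integral_mderiv]) and then Green's second identity
    ([sphere_integral_green]). For harmonic homogeneous polynomials [p] and [q]
    of degrees [l] and [l'] the latter reads
    [0 = (l' - l) * (l + l' + d - 1) * sphere_integral (p * q)]. *)

Local Notation coord := Defs.coord.
Set Implicit Arguments.
Unset Strict Implicit.
Unset Printing Implicit Defensive.

Local Open Scope ring_scope.

(** * Shears preserve Lebesgue measure *)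

Section lebesgue_shear.
Context {R : realType}.
Local Notation RT := (measurableTypeR R).
Local Open Scope classical_set_scope.

Definition translation (c x : RT) : RT := x + c.

Lemma measurable_translation c : measurable_fun setT (translation c).
Proof.
by apply: (@measurable_funD _ RT R setT id (cst c)) => //; exact: measurable_cst.
Qed.

HB.instance Definition _ c :=
  isMeasurableFun.Build _ _ _ _ (translation c) (measurable_translation c).

Lemma lebesgue_measure_translation (c : R) (A : set RT) : measurable A ->
  lebesgue_measure (translation c @^-1` A) = lebesgue_measure A.
Proof.
move=> mA; apply/esym.
apply: (@lebesgue_measure_unique R
  (pushforward lebesgue_measure (translation c))) => //.
move=> X [[a b] _ <-] /=.
rewrite /pushforward (_ : _ @^-1` _ = `]a - c, b - c]%classic); last first.
  by apply/seteqP; split => y; rewrite /translation /= !in_itv/= ltrBlDr lerBrDr.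
rewrite !lebesgue_measure_itv/= !lte_fin ltrD2r; case: ifP => // _.
by rewrite -!EFinB; congr EFin; ring.
Qed.

Lemma product_measure12 d1 d2 (T1 : measurableType d1) (T2 : measurableType d2)
    (m1 : {sigma_finite_measure set T1 -> \bar R})
    (m2 : {sigma_finite_measure set T2 -> \bar R}) (A : set (T1 * T2)) :
  measurable A -> (m1 \x m2)%E A = (m1 \x^ m2)%E A.
Proof.
apply: product_measure_unique => B C mB mC; exact: product_measure2E.
Qed.

Definition shear {n} (i : 'I_n) (h : n.-tuple RT -> R) (t : n.-tuple RT)
  : n.-tuple RT :=
  [tuple tnth t k + (if k == i then h t else 0) | k < n].

Lemma measurable_shear n (i : 'I_n) h :
  measurable_fun setT h -> measurable_fun setT (shear i h).
Proof.
move=> mh; apply/measurable_fun_tnthP => k.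
rewrite (_ : _ \o _ = fun t => tnth t k + (if k == i then h t else 0)); last first.
  by apply/funext => t /=; rewrite tnth_mktuple.
apply: measurable_funD; first exact: measurable_tnth.
by case: (k == i) => //; exact: measurable_cst.
Qed.

(** A shear adds to coordinate [i] a function [h] of the other coordinates, so
    with these others held fixed it is a translation of the line. By Fubini the
    claim follows by induction on the dimension: if [i] is the first coordinate,
    cut along it and use the translation invariance of Lebesgue measure on the
    line; if not, fix the first coordinate and apply the induction hypothesis to
    every slice. Allowing an arbitrary [h] makes the induction work, since a
    slice of a linear shear is only affine. *)
Lemma lebesgue_tuple_shear n (i : 'I_n) (h : n.-tuple RT -> R) :
    measurable_fun setT h ->
    (forall t t', (forall k, k != i -> tnth t k = tnth t' k) -> h t = h t') ->
  forall A, measurable A ->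
  lebesgue_tuple R n (shear i h @^-1` A) = lebesgue_tuple R n A.
Proof.
elim: n => [|n IHn] in i h *; first by case: i.
have mcons : measurable_fun setT (@cons_pair R n).
  exact: (measurable_cons measurable_fst measurable_snd).
move=> mh hi A mA.
have mSA : measurable (shear i h @^-1` A).
  by rewrite -[X in measurable X]setTI; exact: measurable_shear.
have mc B : measurable B -> measurable (@cons_pair R n @^-1` B).
  by move=> mB; rewrite -[X in measurable X]setTI; exact: mcons.
rewrite /= /lebesgue_cons /pushforward.
case: (unliftP ord0 i) => [j|] iE; last first.
  (* Slices at a fixed tail [s] are translated by the constant [c]. *)
  rewrite !product_measure12; [|exact: mc..].
  apply: eq_integral => s _ /=.
  set c := h (cons_pair (0, s)).
  rewrite -[RHS](lebesgue_measure_translation c); last first.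
    by apply: measurable_ysection; exact: mc.
  congr lebesgue_measure; apply/seteqP.
  have shE y : shear i h (cons_pair (y, s)) = cons_pair (y + c, s).
    apply: eq_from_tnth => k; rewrite tnth_mktuple iE.
    rewrite (hi _ (cons_pair (0, s))); last first.
      move=> k'; rewrite iE => k'0.
      by case: (unliftP ord0 k') k'0 => [l|] -> //; rewrite !tnthS.
    by case: (unliftP ord0 k) => [l|] ->; rewrite /= ?tnthS ?tnth0 ?addr0 ?eqxx.
  by split => y; rewrite /= /ysection/= !inE /= /translation shE.
apply: eq_integral => y _ /=.
have mcy : measurable_fun setT (fun s : n.-tuple RT => cons_pair (y, s)).
  exact: (measurableT_comp mcons (pair1_measurable y)).
rewrite -[RHS](IHn j (fun s => h (cons_pair (y, s)))).
- rewrite /=; congr (lebesgue_tuple R n _); apply/seteqP.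
  have shE s : shear i h (cons_pair (y, s)) =
      cons_pair (y, shear j (fun s => h (cons_pair (y, s))) s).
    apply: eq_from_tnth => k; rewrite tnth_mktuple iE.
    case: (unliftP ord0 k) => [l|] ->; last by rewrite /= !tnth0 addr0.
    by rewrite /= !tnthS tnth_mktuple (inj_eq lift_inj).
  by split => s; rewrite /= /xsection/= !inE /= shE.
- exact: (measurableT_comp mh mcy).
- move=> t t' tt'; apply: hi => k; rewrite iE => kj.
  case: (unliftP ord0 k) kj => [l|] -> kj; rewrite ?tnth0//.
  by rewrite /= !tnthS; apply: tt'; apply: contra kj => /eqP ->.
- by apply: measurable_xsection; exact: mc.
Qed.

End lebesgue_shear.

(** * Rotation invariance of the surface measure *)

Section rotations.
Context {R : realType}.
Local Notation RT := (measurableTypeR R).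
Local Open Scope classical_set_scope.

Section rot.
Context {n : nat}.
Implicit Types (i j k : 'I_n) (v : 'I_n -> R) (c s u : R).

Definition rot c s i j v k : R :=
  if k == i then c * v i - s * v j
  else if k == j then s * v i + c * v j
  else v k.

Lemma sum_sqr_rot c s i j v : i != j -> c ^+ 2 + s ^+ 2 = 1 ->
  \sum_k rot c s i j v k ^+ 2 = \sum_k v k ^+ 2.
Proof.
move=> ij cs; have ji : j != i by rewrite eq_sym.
rewrite (bigD1 i)//= (bigD1 j)//= [RHS](bigD1 i)//= [in RHS](bigD1 j)//=.
rewrite /rot !eqxx (negbTE ji) !addrA; congr (_ + _).
  transitivity ((c ^+ 2 + s ^+ 2) * (v i ^+ 2 + v j ^+ 2)); first by ring.
  by rewrite cs mul1r.
by apply: eq_bigr => k /andP[/negbTE -> /negbTE ->].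
Qed.

(** The cosine and the sine of an angle as rational functions of [u], the
    tangent of its half. In this form a rotation is a product of three shears
    with coefficients [- u], [tan_sin u], [- u], and its expansion at [u = 0]
    needs no trigonometry. *)
Definition tan_cos u : R := (1 - u ^+ 2) / (1 + u ^+ 2).
Definition tan_sin u : R := 2 * u / (1 + u ^+ 2).

Lemma one_plus_sqr_neq0 u : 1 + u ^+ 2 != 0.
Proof. by rewrite gt_eqF// ltr_pwDl// sqr_ge0. Qed.

Lemma tan_cos2Dsin2 u : tan_cos u ^+ 2 + tan_sin u ^+ 2 = 1.
Proof. by rewrite /tan_cos /tan_sin; field; exact: one_plus_sqr_neq0. Qed.

Definition rot_tuple c s i j (t : n.-tuple RT) : n.-tuple RT :=
  [tuple rot c s i j (tnth t) k | k < n].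

Lemma rot_tupleE u i j t : i != j ->
  let h := fun t : n.-tuple RT => - u * tnth t j in
  let h' := fun t : n.-tuple RT => tan_sin u * tnth t i in
  rot_tuple (tan_cos u) (tan_sin u) i j t = shear i h (shear j h' (shear i h t)).
Proof.
move=> ij h h'; have ji : j != i by rewrite eq_sym.
apply: eq_from_tnth => k; rewrite !tnth_mktuple /h /h' !tnth_mktuple.
rewrite !eqxx ?(negbTE ij) (negbTE ji) /rot /tan_cos /tan_sin.
case: eqVneq => [->|_].
  by rewrite (negbTE ij); field; exact: one_plus_sqr_neq0.
case: eqVneq => [->|_]; last by rewrite !addr0.
by field; exact: one_plus_sqr_neq0.
Qed.

Lemma measurable_rot_tuple c s i j : measurable_fun setT (rot_tuple c s i j).
Proof.
apply/measurable_fun_tnthP => k.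
rewrite (_ : _ \o _ = fun t => rot c s i j (tnth t) k); last first.
  by apply/funext => t /=; rewrite tnth_mktuple.
have mZ a l : measurable_fun setT (fun t : n.-tuple RT => a * tnth t l).
  by apply: measurable_funM; [exact: measurable_cst|exact: measurable_tnth].
rewrite /rot; case: (k == i); first exact: measurable_funB.
by case: (k == j); [exact: measurable_funD|exact: measurable_tnth].
Qed.

(** Each of the three shears of [rot_tupleE] preserves the measure. *)
Lemma lebesgue_tuple_rot u i j (A : set (n.-tuple RT)) : i != j ->
    measurable A ->
  lebesgue_tuple R n (rot_tuple (tan_cos u) (tan_sin u) i j @^-1` A) =
  lebesgue_tuple R n A.
Proof.
move=> ij mA; have ji : j != i by rewrite eq_sym.
set h := fun t : n.-tuple RT => - u * tnth t j.
set h' := fun t : n.-tuple RT => tan_sin u * tnth t i.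
have mh : measurable_fun setT h.
  by apply: measurable_funM; [exact: measurable_cst|exact: measurable_tnth].
have mh' : measurable_fun setT h'.
  by apply: measurable_funM; [exact: measurable_cst|exact: measurable_tnth].
have hi t t' : (forall k, k != i -> tnth t k = tnth t' k) -> h t = h t'.
  by move=> tt'; rewrite /h tt'.
have hj t t' : (forall k, k != j -> tnth t k = tnth t' k) -> h' t = h' t'.
  by move=> tt'; rewrite /h' tt'.
have mS k g (B : set (n.-tuple RT)) : measurable_fun setT g -> measurable B ->
    measurable (shear k g @^-1` B).
  by move=> mg mB; rewrite -[X in measurable X]setTI; exact: measurable_shear.
rewrite -[RHS](lebesgue_tuple_shear mh hi mA).
rewrite -[RHS](lebesgue_tuple_shear mh' hj); last exact: mS.
rewrite -[RHS](lebesgue_tuple_shear mh hi); last by apply: (mS) => //; exact: mS.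
by congr (lebesgue_tuple R n _); apply/seteqP; split => t; rewrite /= rot_tupleE.
Qed.

End rot.

Definition cube n : set (n.-tuple RT) :=
  [set t | forall k, -1 <= (tnth t k : R) <= 1].
Arguments cube : clear implicits.

Lemma measurable_cube n : measurable (cube n).
Proof.
rewrite (_ : cube n =
    \bigcap_(k in [set: 'I_n]) ((@tnth n RT)^~ k @^-1` (`[-1, 1]%classic : set R))).
  apply: fin_bigcap_measurable => [|k _]; first exact: finite_finset.
  rewrite -[X in measurable X]setTI.
  exact: measurable_tnth.
apply/seteqP; split=> t /= ht k.
  by move=> _; rewrite /= in_itv/=; exact: ht.
by have := ht k I; rewrite /= in_itv.
Qed.

Lemma lebesgue_tuple_cube n : (lebesgue_tuple R n (cube n) < +oo)%E.
Proof.
elim: n => [|n IHn].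
  by rewrite /= diracE; case: (_ \in _); rewrite ltry.
rewrite /= /lebesgue_cons /pushforward.
rewrite (_ : _ @^-1` _ = (`[-1, 1]%classic : set R) `*` cube n); last first.
  apply/seteqP; split => [[y s] /= ht|[y s] /= [hy hs] k].
    split; first by have := ht ord0; rewrite tnth0 in_itv.
    by move=> k; have := ht (lift ord0 k); rewrite tnthS.
  by move: hy; rewrite in_itv/= => hy;
    case: (unliftP ord0 k) => [l|] ->; rewrite ?tnth0 ?tnthS.
rewrite product_measure1E//; last exact: measurable_cube.
rewrite lte_mul_pinfty// ge0_fin_numE//.
have : (lebesgue_measure ([set` `[-1, 1]%R] : set R) < +oo)%E.
  by rewrite lebesgue_measure_itv/=; case: ifP => _; rewrite ltry.
exact.
Qed.

End rotations.

Section sphere_rotations.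
Context {R : realType} {d : nat}.
Local Notation RT := (measurableTypeR R).
Local Open Scope classical_set_scope.
Local Notation S := (Sphere R d).
Implicit Types (i j k : 'I_d.+1) (x : S).

Lemma sum_sqr_coord x : \sum_k coord x k ^+ 2 = 1.
Proof. by have := set_valP x. Qed.

Lemma rot_sphere_subproof i j u x : i != j ->
  (\row_k rot (tan_cos u) (tan_sin u) i j (coord x) k) \in @sphere R d.
Proof.
move=> ij; rewrite inE /sphere /=; under eq_bigr do rewrite mxE.
by rewrite sum_sqr_rot// ?sum_sqr_coord// tan_cos2Dsin2.
Qed.

Definition rot_sphere i j (ij : i != j) u x : S :=
  exist _ (\row_k rot (tan_cos u) (tan_sin u) i j (coord x) k)
    (rot_sphere_subproof u x ij).

Lemma coord_rot_sphere i j (ij : i != j) u x :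
  coord (rot_sphere ij u x) =1 rot (tan_cos u) (tan_sin u) i j (coord x).
Proof. by move=> k; rewrite {1}/coord set_valE /= mxE. Qed.

Lemma coord_inj x y : coord x =1 coord y -> x = y.
Proof.
move=> xy; apply: val_inj; apply/rowP => k.
by have := xy k; rewrite /coord !set_valE.
Qed.

Lemma measurable_coord_tuple : measurable_fun setT (@coord_tuple R d).
Proof. by move=> _ B mB; rewrite setTI; exists B => //; rewrite setTI. Qed.

Lemma measurable_coord k : measurable_fun setT (fun x : S => coord x k).
Proof.
rewrite (_ : (fun x => _) = (@tnth _ _)^~ k \o @coord_tuple R d).
  exact: measurableT_comp (measurable_tnth k) measurable_coord_tuple.
by apply/funext => x /=; rewrite tnth_mktuple.
Qed.

Lemma measurable_rot_sphere i j (ij : i != j) u :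
  measurable_fun setT (rot_sphere ij u).
Proof.
have := measurableT_comp (measurable_rot_tuple (tan_cos u) (tan_sin u) i j)
  measurable_coord_tuple.
rewrite (_ : _ \o _ = @coord_tuple R d \o rot_sphere ij u) => [mr|].
  by move=> _ _ [C mC <-]; rewrite !setTI -comp_preimage
    -[X in measurable X]setTI; exact: mr.
apply/funext => x; apply: eq_from_tnth => k /=.
rewrite !tnth_mktuple coord_rot_sphere /rot.
by rewrite !tnth_mktuple.
Qed.

HB.instance Definition _ i j (ij : i != j) u :=
  isMeasurableFun.Build _ _ _ _ (rot_sphere ij u) (measurable_rot_sphere ij u).

Lemma euclid_norm_rot i j u (t : d.+1.-tuple RT) : i != j ->
  euclid_norm (rot_tuple (tan_cos u) (tan_sin u) i j t) = euclid_norm t.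
Proof.
move=> ij; rewrite /euclid_norm; congr Num.sqrt.
rewrite -[RHS](sum_sqr_rot _ ij (tan_cos2Dsin2 u)).
by apply: eq_bigr => k _; rewrite tnth_mktuple.
Qed.

Lemma coord_sphere_proj (t : d.+1.-tuple RT) k : euclid_norm t != 0 ->
  coord (sphere_proj t) k = tnth t k / euclid_norm t.
Proof.
by move=> t0; rewrite /coord set_valE /= /radial (negbTE t0) mxE.
Qed.

Lemma sphere_proj_rot i j (ij : i != j) u t : euclid_norm t != 0 ->
  sphere_proj (rot_tuple (tan_cos u) (tan_sin u) i j t) =
  rot_sphere ij u (sphere_proj t).
Proof.
move=> t0; apply: coord_inj => k; rewrite coord_rot_sphere.
rewrite coord_sphere_proj ?euclid_norm_rot// tnth_mktuple /rot.
rewrite !coord_sphere_proj//.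
by case: ifP => _; [|case: ifP => _]; ring.
Qed.

(** A rotation preserves the Euclidean norm and commutes with the radial
    projection, so it maps the solid cone over a set to the solid cone over the
    rotated set. *)
Lemma surface_measure_rot i j (ij : i != j) u (A : set S) : measurable A ->
  surface_measure R d (rot_sphere ij u @^-1` A) = surface_measure R d A.
Proof.
move=> mA; rewrite /surface_measure /mscale /=; congr (_ * _)%E.
rewrite /cone_measure /pushforward /mrestr.
have mB : measurable (@sphere_proj R d @^-1` A `&` punctured_ball (d:=d)).
  apply: measurableI; last exact: measurable_punctured_ball.
  by rewrite -[X in measurable X]setTI; exact: (measurable_funPT (@sphere_proj R d)).
rewrite -[RHS](lebesgue_tuple_rot u ij mB); congr (lebesgue_tuple R d.+1 _).
apply/seteqP; split => t /= []; rewrite /punctured_ball /= => At /andP[t0 t1];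
  move: At t0 t1; rewrite ?euclid_norm_rot// => At t0 t1; split;
  rewrite ?t0 ?t1//; move: At; rewrite sphere_proj_rot// ?gt_eqF//.
Qed.

Lemma punctured_ball_cube : punctured_ball (d:=d) `<=` @cube R d.+1.
Proof.
move=> t /andP[_ t1] k; rewrite -ler_norml.
rewrite -(ler_pXn2r (n:=2)) ?nnegrE// real_normK ?num_real// expr1n.
have t2 : \sum_i tnth t i ^+ 2 <= 1.
  have s0 : 0 <= \sum_i tnth t i ^+ 2 by apply: sumr_ge0 => i _; exact: sqr_ge0.
  rewrite -(sqr_sqrtr s0) -[leRHS](expr1n _ 2).
  by rewrite ler_pXn2r ?nnegrE ?sqrtr_ge0.
apply: le_trans t2; rewrite (bigD1 k)//= lerDl.
by apply: sumr_ge0 => i _; exact: sqr_ge0.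
Qed.

(** The cone over the whole sphere is the punctured ball, which lies in a cube. *)
Lemma surface_measure_finite : (surface_measure R d setT < +oo)%E.
Proof.
rewrite /surface_measure /mscale /= lte_mul_pinfty//.
rewrite /cone_measure /pushforward /mrestr preimage_setT setTI.
apply: le_lt_trans (lebesgue_tuple_cube d.+1).
apply: le_measure; rewrite ?inE; [exact: measurable_punctured_ball|
  exact: measurable_cube|exact: punctured_ball_cube].
Qed.

End sphere_rotations.

(** * Integrals of polynomials over the sphere *)

Section polynomial_functions.
Context {R : realType} {d : nat}.
Local Notation S := (Sphere R d).
Local Notation polynomial := (mpoly.mpoly d.+1 R).
Implicit Types (p q : polynomial) (x : S) (i j k : 'I_d.+1).
Local Notation "'X_ i" := (mpoly.mpolyX R (mpoly.mnm1 i)).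
Local Notation D := (@mpoly.mderiv d.+1 R).

(** Induction for properties that are stable under the ring operations, such as
    boundedness, measurability or differentiability. *)
Lemma mpoly_ring_ind (P : polynomial -> Prop) :
    (forall c, P (mpoly.mpolyC d.+1 c)) -> (forall i, P 'X_i) ->
    (forall p q, P p -> P q -> P (p + q)) ->
    (forall p q, P p -> P q -> P (p * q)) ->
  forall p, P p.
Proof.
move=> PC PX PD PM; elim/mpoly.mpolyind => [|c m p _ _ Pp].
  by rewrite -mpoly.mpolyC0; exact: PC.
apply: (PD) Pp; rewrite -mpoly.mul_mpolyC; apply: (PM); first exact: PC.
rewrite mpoly.mpolyXE_id; elim/big_ind: _ => [|p1 p2|i _]; last 1 first.
- elim: (m i) => [|e IHe]; last by rewrite exprS; apply: (PM).
  by rewrite expr0 -mpoly.mpolyC1; exact: PC.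
- by rewrite -mpoly.mpolyC1; exact: PC.
- exact: PM.
Qed.

Lemma restrict_polyC c x : restrict_poly (mpoly.mpolyC d.+1 c) x = c.
Proof. exact: mpoly.mevalC. Qed.
Lemma restrict_poly0 x : restrict_poly 0 x = 0.
Proof. exact: mpoly.meval0. Qed.
Lemma restrict_polyX i x : restrict_poly 'X_i x = coord x i.
Proof. exact: mpoly.mevalXU. Qed.
Lemma restrict_polyD p q x :
  restrict_poly (p + q) x = restrict_poly p x + restrict_poly q x.
Proof. exact: mpoly.mevalD. Qed.
Lemma restrict_polyM p q x :
  restrict_poly (p * q) x = restrict_poly p x * restrict_poly q x.
Proof. exact: mpoly.mevalM. Qed.
Lemma restrict_polyZ c p x :
  restrict_poly (c *: p) x = c * restrict_poly p x.
Proof. exact: mpoly.mevalZ. Qed.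

Lemma coord_le1 x i : `|coord x i| <= 1.
Proof.
rewrite -(ler_pXn2r (n:=2)) ?nnegrE// real_normK ?num_real// expr1n.
rewrite -(sum_sqr_coord x) (bigD1 i)//= lerDl.
by apply: sumr_ge0 => k _; exact: sqr_ge0.
Qed.

Lemma restrict_poly_bounded p :
  exists2 C : R, 0 <= C & forall x, `|restrict_poly p x| <= C.
Proof.
elim/mpoly_ring_ind: p => [c|i|p q [C C0 hC] [C' C'0 hC']|p q [C C0 hC] [C' C'0 hC']].
- by exists `|c| => // x; rewrite restrict_polyC.
- by exists 1 => // x; rewrite restrict_polyX coord_le1.
- exists (C + C') => [|x]; first exact: addr_ge0.
  by rewrite restrict_polyD (le_trans (ler_normD _ _))// lerD.
- exists (C * C') => [|x]; first exact: mulr_ge0.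
  by rewrite restrict_polyM normrM ler_pM.
Qed.

Lemma measurable_restrict_poly p :
  measurable_fun setT (restrict_poly p : S -> R).
Proof.
elim/mpoly_ring_ind: p => [c|i|p q mp mq|p q mp mq].
- apply: (eq_measurable_fun (cst c)) => [x _|]; first by rewrite restrict_polyC.
  exact: measurable_cst.
- apply: (eq_measurable_fun (fun x : S => coord x i)) => [x _|].
    by rewrite restrict_polyX.
  exact: measurable_coord.
- apply: eq_measurable_fun (measurable_funD mp mq) => x _.
  by rewrite restrict_polyD.
- apply: eq_measurable_fun (measurable_funM mp mq) => x _.
  by rewrite restrict_polyM.
Qed.

Lemma integrable_bounded (f : S -> R) (C : R) :
    measurable_fun setT f -> (forall x, `|f x| <= C) ->
  (surface_measure R d).-integrable setT (EFin \o f).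
Proof.
move=> mf fC; apply: measurable_bounded_integrable => //.
  exact: surface_measure_finite.
exists C; split; first exact: num_real.
by move=> M CM x _; exact: le_trans (fC x) (ltW CM).
Qed.

Lemma integrable_restrict_poly p :
  (surface_measure R d).-integrable setT (EFin \o restrict_poly p).
Proof.
have [C _ hC] := restrict_poly_bounded p.
exact: integrable_bounded (measurable_restrict_poly p) hC.
Qed.

Definition sphere_integral p : R :=
  \int[surface_measure R d]_x restrict_poly p x.

Lemma sphere_integralD p q :
  sphere_integral (p + q) = sphere_integral p + sphere_integral q.
Proof.
rewrite /sphere_integral -RintegralD//; try exact: integrable_restrict_poly.
by apply: eq_Rintegral => x _; exact: restrict_polyD.
Qed.

Lemma sphere_integralZ c p : sphere_integral (c *: p) = c * sphere_integral p.
Proof.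
rewrite /sphere_integral -RintegralZl//; last exact: integrable_restrict_poly.
by apply: eq_Rintegral => x _; exact: restrict_polyZ.
Qed.

Lemma sphere_integral0 : sphere_integral 0 = 0.
Proof. by rewrite -(scale0r 0) sphere_integralZ mul0r. Qed.

Lemma sphere_integralB p q :
  sphere_integral (p - q) = sphere_integral p - sphere_integral q.
Proof. by rewrite sphere_integralD -scaleN1r sphere_integralZ mulN1r. Qed.

Lemma sphere_integral_sum (I : finType) (F : I -> polynomial) :
  sphere_integral (\sum_i F i) = \sum_i sphere_integral (F i).
Proof.
exact: (big_morph _ sphere_integralD sphere_integral0).
Qed.

Lemma sphere_integral_rot i j (ij : i != j) u p :
  \int[surface_measure R d]_x restrict_poly p (rot_sphere ij u x) =
  sphere_integral p.
Proof.
rewrite /sphere_integral /Rintegral; congr fine.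
transitivity (\int[pushforward (surface_measure R d) (rot_sphere ij u)]_x
    (restrict_poly p x)%:E)%E; last first.
  by apply: eq_measure_integral => A mA _; exact: surface_measure_rot.
have [C _ hC] := restrict_poly_bounded p.
rewrite integral_pushforward// ?preimage_setT//.
- by apply/measurable_EFinP; exact: measurable_restrict_poly.
- apply: (@integrable_bounded (fun x => restrict_poly p (rot_sphere ij u x)) C).
    exact: measurableT_comp (measurable_restrict_poly p) (measurable_rot_sphere ij u).
  by move=> x; exact: hC.
Qed.

(** The derivative of a polynomial along the rotations of the plane of the
    coordinates [i] and [j]. *)
Definition angular i j p : polynomial := 'X_i * D j p - 'X_j * D i p.

Lemma angularD i j : {morph angular i j : p q / p + q}.
Proof. by move=> p q; rewrite /angular !mpoly.mderivD; ring. Qed.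

Lemma angularM i j p q :
  angular i j (p * q) = angular i j p * q + p * angular i j q.
Proof. by rewrite /angular !mpoly.mderivM; ring. Qed.

Lemma angularC i j c : angular i j (mpoly.mpolyC d.+1 c) = 0.
Proof. by rewrite /angular !mpoly.mderivC !mulr0 subr0. Qed.

Lemma mderivU k i : D k 'X_i = (k == i)%:R.
Proof.
rewrite mpoly.mderivX mpoly.mnm1E eq_sym; case: eqVneq => [->|_].
  rewrite scale1r (_ : mpoly.mnm_sub _ _ = mpoly.mnm0) ?mpoly.mpolyX0//.
  by apply/mpoly.mnmP => l; rewrite mpoly.mnmBE mpoly.mnm0E subnn.
by rewrite scale0r.
Qed.

(** A first-order expansion that is uniform on the sphere. The factor [2] is the
    derivative at [0] of the angle [2 * atan u]. The property passes from the
    coordinates to all polynomials because [angular] is a derivation. *)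
Lemma restrict_poly_rot_taylor i j (ij : i != j) p :
  exists2 C : R, 0 <= C & forall u x, `|u| <= 1 ->
    `|restrict_poly p (rot_sphere ij u x) - restrict_poly p x -
      2 * u * restrict_poly (angular i j p) x| <= C * u ^+ 2.
Proof.
have ji : j != i by rewrite eq_sym.
elim/mpoly_ring_ind: p => [c|k|p q [C C0 hC] [C' C'0 hC']|p q [C C0 hC] [C' C'0 hC']].
- exists 0 => // u x _.
  by rewrite angularC !restrict_polyC subrr mulr0 subrr normr0 mul0r.
- exists 4 => // u x u1.
  rewrite /angular !mderivU -!mpoly.mpolyC_nat /restrict_poly mpoly.mevalB.
  rewrite !mpoly.mevalM !mpoly.mevalC !mpoly.mevalXU coord_rot_sphere /rot.
  have u0 : 0 <= u ^+ 2 by exact: sqr_ge0.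
  (* Every error term is - 2 u^2 / (1 + u^2) times such a combination. *)
  have key (a b e : R) : `|a| <= 1 -> `|b| <= 1 ->
      e = - (2 * u ^+ 2 / (1 + u ^+ 2) * (a + u * b)) -> `|e| <= 4 * u ^+ 2.
    have d0 : 0 <= 2 * u ^+ 2 / (1 + u ^+ 2)
      by apply: divr_ge0; [exact: mulr_ge0|exact: addr_ge0].
    move=> a1 b1 ->; rewrite normrN normrM (ger0_norm d0).
    have ab : `|a + u * b| <= 2.
      rewrite (le_trans (ler_normD _ _))// normrM.
      have : `|u| * `|b| <= 1 by rewrite mulr_ile1.
      by move: a1; lra.
    have : (1 + u ^+ 2)^-1 <= 1 by rewrite invf_le1 ?lerDl// ltr_pwDl.
    move=> v1; have v0 : 0 <= (1 + u ^+ 2)^-1 by rewrite invr_ge0 addr_ge0.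
    rewrite (_ : 4 * _ = 2 * u ^+ 2 * 1 * 2); last by ring.
    by apply: ler_pM => //; apply: ler_pM => //; exact: mulr_ge0.
  have u2 := one_plus_sqr_neq0 u.
  case: eqVneq => [->|ki].
    rewrite (negbTE ji) mulr1n mulr0n; apply: (key (coord x i) (- coord x j)).
    + exact: coord_le1.
    + by rewrite normrN coord_le1.
    + by rewrite /tan_cos /tan_sin; field.
  case: eqVneq => [->|kj].
    rewrite mulr1n mulr0n; apply: (key (coord x j) (coord x i)).
    + exact: coord_le1.
    + exact: coord_le1.
    + by rewrite /tan_cos /tan_sin; field.
  rewrite !mulr0n !mulr0 !subrr mulr0 subrr normr0.
  exact: mulr_ge0.
- exists (C + C') => [|u x u1]; first exact: addr_ge0.
  rewrite angularD !(restrict_polyD p q) (restrict_polyD (angular i j p)) [leRHS]mulrDl.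
  apply: le_trans (lerD (hC u x u1) (hC' u x u1)).
  apply: le_trans (ler_normD _ _); rewrite le_eqVlt; apply/orP; left.
  by apply/eqP; congr `|_|; ring.
- have [Kp Kp0 hp] := restrict_poly_bounded p.
  have [Kq Kq0 hq] := restrict_poly_bounded q.
  have [Lp Lp0 hLp] := restrict_poly_bounded (angular i j p).
  have [Lq Lq0 hLq] := restrict_poly_bounded (angular i j q).
  exists (C * Kq + Kp * C' + 2 * Lp * (C' + 2 * Lq)) => [|u x u1].
    by rewrite !(addr_ge0, mulr_ge0).
  move: (hC u x u1) (hC' u x u1) (hp x) (hq (rot_sphere ij u x)) (hLp x) (hLq x).
  rewrite angularM (restrict_polyD (angular i j p * q)).
  rewrite !(restrict_polyM p) (restrict_polyM (angular i j p)).
  move: (restrict_poly p x) (restrict_poly q x) => a b.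
  move: (restrict_poly p _) (restrict_poly q _) => a' b'.
  move: (restrict_poly (angular i j p) x) => la.
  move: (restrict_poly (angular i j q) x) => lb.
  set A := a' - _ - _; set B := b' - _ - _ => hA hB ha hb hla hlb.
  rewrite (_ : _ - _ = A * b' + a * B + 2 * la * (u * B + u * u * (2 * lb)));
    last by rewrite /A /B; ring.
  have u0 : 0 <= u ^+ 2 by exact: sqr_ge0.
  rewrite (le_trans (ler_normD _ _))// [leRHS]mulrDl lerD//.
    rewrite (le_trans (ler_normD _ _))// [leRHS]mulrDl lerD//.
      by rewrite normrM mulrAC ler_pM.
    by rewrite normrM -[leRHS]mulrA ler_pM.
  have h1 : `|2 * la| <= 2 * Lp by rewrite normrM ger0_norm// ler_pM2l.
  have h2 : `|u * B + u * u * (2 * lb)| <= (C' + 2 * Lq) * u ^+ 2.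
    rewrite (le_trans (ler_normD _ _))// [leRHS]mulrDl lerD//.
      by rewrite normrM -[leRHS]mul1r ler_pM.
    rewrite -expr2 normrM (ger0_norm u0) mulrC ler_wpM2r// normrM.
    by rewrite ger0_norm// ler_pM2l.
  by rewrite normrM -[leRHS]mulrA ler_pM.
Qed.

(** By rotation invariance the integral of [p] along the rotations is constant
    in [u], and by the Taylor estimate its derivative at [u = 0] is twice the
    integral of [angular i j p]. *)
Lemma sphere_integral_angular i j p : i != j ->
  sphere_integral (angular i j p) = 0.
Proof.
move=> ij; have [C C0 hC] := restrict_poly_rot_taylor ij p.
set mu := surface_measure R d; set K := C * fine (mu setT).
have K0 : 0 <= K by rewrite mulr_ge0// fine_ge0.
have I0 u : 0 < u -> u <= 1 -> 2 * `|sphere_integral (angular i j p)| <= K * u.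
  move=> u0 u1; have u1' : `|u| <= 1 by rewrite ger0_norm// ltW.
  pose e x := restrict_poly p (rot_sphere ij u x) - restrict_poly p x -
      2 * u * restrict_poly (angular i j p) x.
  have irot : mu.-integrable setT
      (EFin \o (fun x => restrict_poly p (rot_sphere ij u x))).
    have [B _ hB] := restrict_poly_bounded p.
    apply: (integrable_bounded (C := B)) => [|x]; last exact: hB.
    exact: measurableT_comp (measurable_restrict_poly p) (measurable_rot_sphere ij u).
  have iB : mu.-integrable setT (EFin \o (fun x =>
      restrict_poly p (rot_sphere ij u x) - restrict_poly p x)).
    exact: (integrableB measurableT irot (integrable_restrict_poly p)).
  have iZ : mu.-integrable setT
      (EFin \o (fun x => 2 * u * restrict_poly (angular i j p) x)).
    exact: (integrableZl measurableT (2 * u) (integrable_restrict_poly _)).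
  have ie : mu.-integrable setT (EFin \o e).
    exact: (integrableB measurableT iB iZ).
  have eI : \int[mu]_x e x = - (2 * u * sphere_integral (angular i j p)).
    rewrite /e RintegralB// RintegralB//; last exact: integrable_restrict_poly.
    rewrite sphere_integral_rot subrr sub0r RintegralZl//.
    exact: integrable_restrict_poly.
  have : `|\int[mu]_x e x| <= K * u ^+ 2.
    apply: le_trans (le_normr_Rintegral measurableT ie) _.
    rewrite /K mulrAC -Rintegral_cst//; apply: le_Rintegral => //.
    - exact: integrable_norm.
    - apply: (integrable_bounded (C := C * u ^+ 2)) => // x.
      by rewrite ger0_norm// mulr_ge0// sqr_ge0.
    - by move=> x _; exact: hC.
  rewrite eI normrN !normrM (ger0_norm (ltW u0)) ger0_norm// expr2 mulrA.
  by rewrite mulrAC ler_pM2r.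
apply/eqP; rewrite -normr_le0; apply/ler_addgt0Pr => e e0; rewrite add0r.
have K1 : 0 < K + 1 by rewrite ltr_wpDl.
(* The minimum keeps [u] in the range of [I0]. *)
pose u := Num.min 1 (e / (K + 1)).
have u0 : 0 < u by rewrite lt_min ltr01 divr_gt0.
have := I0 u u0; rewrite ge_min lexx => /(_ isT) h.
have ue : u <= e / (K + 1) by rewrite ge_min lexx orbT.
have : (K + 1) * u <= e by rewrite mulrC -ler_pdivlMr.
have := normr_ge0 (sphere_integral (angular i j p)).
by rewrite mulrDl mul1r; move: h u0; set Ku := K * u; lra.
Qed.

End polynomial_functions.

(** * Orthogonality of harmonics of different degrees *)

Section harmonic_orthogonality.
Context {R : realType} {d : nat}.
Local Notation S := (Sphere R d).
Local Notation polynomial := (mpoly.mpoly d.+1 R).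
Implicit Types (p q : polynomial) (x : S) (i j k : 'I_d.+1).
Local Notation "'X_ i" := (mpoly.mpolyX R (mpoly.mnm1 i)).
Local Notation D := (@mpoly.mderiv d.+1 R).

Definition euler p : polynomial := \sum_j 'X_j * D j p.

Lemma eulerM p q : euler (p * q) = euler p * q + p * euler q.
Proof.
rewrite /euler mulr_suml mulr_sumr -big_split/=.
by apply: eq_bigr => j _; rewrite mpoly.mderivM; ring.
Qed.

Lemma eulerZ c p : euler (c *: p) = c *: euler p.
Proof.
by rewrite /euler scaler_sumr; apply: eq_bigr => j _;
  rewrite mpoly.mderivZ scalerAr.
Qed.

Lemma euler_sum (I : Type) (r : seq I) (F : I -> polynomial) :
  euler (\sum_(i <- r) F i) = \sum_(i <- r) euler (F i).
Proof.
rewrite /euler exchange_big/=; apply: eq_bigr => j _.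
by rewrite raddf_sum mulr_sumr.
Qed.

Lemma eulerX i : euler 'X_i = 'X_i.
Proof.
rewrite /euler (bigD1 i)//= mderivU eqxx mulr1 big1 ?addr0// => j ji.
by rewrite mderivU (negbTE ji) mulr0.
Qed.

Lemma euler_homogeneous l p :
  p \is mpoly.ishomog1 l mpoly.mdeg -> euler p = l%:R *: p.
Proof.
move=> /mpoly.dhomogP hp; rewrite [in LHS](mpoly.mpolyE p) [in RHS](mpoly.mpolyE p).
rewrite euler_sum scaler_sumr; apply: eq_big_seq => m mp.
have <- : mpoly.mdeg m = l := hp m mp.
rewrite eulerZ scalerA mulrC -scalerA; congr (_ *: _).
rewrite /euler mpoly.mdegE natr_sum scaler_suml; apply: eq_bigr => j _.
rewrite mpoly.mderivX -scalerAr; case: (posnP (m j)) => [->|mj].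
  by rewrite !scale0r.
rewrite -mpoly.mpolyXD; congr (_ *: mpoly.mpolyX R _).
by apply/mpoly.mnmP => k; rewrite mpoly.mnmDE mpoly.mnmBE mpoly.mnm1E;
  case: eqVneq => [<-|_]; rewrite ?subn0// add1n subn1 prednK.
Qed.

Definition norm_sqr : polynomial := \sum_j 'X_j * 'X_j.

Lemma sphere_integral_norm_sqr p :
  sphere_integral (norm_sqr * p) = sphere_integral p.
Proof.
apply: eq_Rintegral => x _; rewrite restrict_polyM -[RHS]mul1r; congr (_ * _).
rewrite /restrict_poly raddf_sum -(sum_sqr_coord x).
by apply: eq_bigr => j _; rewrite /= mpoly.mevalM mpoly.mevalXU expr2.
Qed.

(** The divergence theorem on the sphere for one partial derivative. Summing
    [angular j i ('X_j * q)] over [j] produces [norm_sqr * D i q], whose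
    integral is that of [D i q] since [norm_sqr] is [1] on the sphere, and the
    terms of the right-hand side; the integral of the sum is zero. *)
Lemma sphere_integral_mderiv i q :
  sphere_integral (D i q) =
  sphere_integral (d%:R *: ('X_i * q) + 'X_i * euler q).
Proof.
have angE : \sum_j angular j i ('X_j * q) =
    norm_sqr * D i q - (d%:R *: ('X_i * q) + 'X_i * euler q).
  rewrite /angular sumrB; transitivity (
      (\sum_j (i == j)%:R * ('X_j * q) + \sum_j 'X_j * 'X_j * D i q) -
      ('X_i * \sum_(j < d.+1) q + 'X_i * \sum_j 'X_j * D j q)).
    rewrite -big_split/= !mulr_sumr -big_split/= -!sumrB.
    by apply: eq_bigr => j _; rewrite !mpoly.mderivM !mderivU eqxx mulr1n; ring.
  rewrite -mulr_suml -/norm_sqr -/(euler q) (bigD1 i)//= eqxx mul1r big1; last first.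
    by move=> j /negbTE ji; rewrite eq_sym ji mul0r.
  rewrite sumr_const card_ord -scaler_nat -scalerAr -natr1 scalerDl scale1r; ring.
have : sphere_integral (\sum_j angular j i ('X_j * q)) = 0.
  rewrite sphere_integral_sum big1// => j _.
  have [->|ji] := eqVneq j i; last exact: sphere_integral_angular.
  by rewrite /angular subrr sphere_integral0.
rewrite angE sphere_integralB sphere_integral_norm_sqr => /eqP.
by rewrite subr_eq0 => /eqP.
Qed.

(** Green's second identity: the field [V i = p * D i q - q * D i p] has
    divergence [p * laplacian q - q * laplacian p] and radial component
    [p * euler q - q * euler p], and [sphere_integral_mderiv] applies to each of
    its components. *)
Lemma sphere_integral_green p q :
  sphere_integral (p * laplacian q - q * laplacian p) =
  sphere_integral (euler (p * euler q - q * euler p) +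
    (d%:R - 1) *: (p * euler q - q * euler p)).
Proof.
pose V i := p * D i q - q * D i p.
have -> : p * laplacian q - q * laplacian p = \sum_i D i (V i).
  rewrite /laplacian !mulr_sumr -sumrB; apply: eq_bigr => i _.
  by rewrite /V mpoly.mderivB !mpoly.mderivM; ring.
have WE : p * euler q - q * euler p = \sum_i 'X_i * V i.
  rewrite /euler !mulr_sumr -sumrB; apply: eq_bigr => i _.
  by rewrite /V; ring.
rewrite WE sphere_integral_sum; under eq_bigr do rewrite sphere_integral_mderiv.
rewrite -sphere_integral_sum euler_sum scaler_sumr -big_split/=; congr sphere_integral.
apply: eq_bigr => i _; rewrite eulerM eulerX scalerBl scale1r; ring.
Qed.

(** In Green's identity the left-hand side vanishes, and for homogeneous
    polynomials the right-hand side is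
    [(l' - l) * (l + l' + d - 1)] times the integral of [p * q], where the
    second factor is positive. *)
Lemma sphere_integral_harmonic l l' p q :
    p \is mpoly.ishomog1 l mpoly.mdeg -> laplacian p = 0 ->
    q \is mpoly.ishomog1 l' mpoly.mdeg -> laplacian q = 0 ->
  (2 <= d)%N -> l != l' -> sphere_integral (p * q) = 0.
Proof.
move=> hp Lp hq Lq hd ll'.
have := sphere_integral_green p q; rewrite Lp Lq !mulr0 subrr sphere_integral0.
rewrite !(euler_homogeneous hp) (euler_homogeneous hq) -!scalerAr (mulrC q p).
rewrite -scalerBl eulerZ eulerM (euler_homogeneous hp) (euler_homogeneous hq).
rewrite -scalerAl -scalerAr -scalerDl !scalerA -scalerDl sphere_integralZ.
move=> /esym/eqP; rewrite mulf_eq0 => /orP[|/eqP//].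
rewrite mulrC -mulrDl mulf_eq0 => /orP[|].
  by rewrite gt_eqF// ltr_wpDl// ?addr_ge0// subr_gt0 ltr1n.
by rewrite subr_eq0 eqr_nat eq_sym (negbTE ll').
Qed.

End harmonic_orthogonality.

(** * Hyperinterpolation and hard thresholding *)

Section continuous_product.
Context {R : realType} {X : topologicalType}.
Implicit Types f g : continuousType X R.

Lemma cts_mul_continuous f g : continuous (fun y => f y * g y).
Proof. by move=> y; apply: cvgM; exact: cts_fun. Qed.

Definition cts_mul f g : continuousType X R := mkcts (@cts_mul_continuous f g).

Lemma cts_one_continuous : continuous (fun _ : X => 1 : R).
Proof. by move=> y; exact: cvg_cst. Qed.

Definition cts_one : continuousType X R := mkcts cts_one_continuous.

End continuous_product.

Section spherical_functions.
Context {R : realType} {d : nat}.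
Local Notation C := (continuousType (Sphere R d) R).
Implicit Types f g : C.

Lemma cts_addE f g y : (f + g) y = f y + g y. Proof. by []. Qed.
Lemma cts_scaleE a f y : (a *: f) y = a * f y. Proof. by []. Qed.
Lemma cts_zeroE y : (0 : C) y = 0. Proof. by []. Qed.

Lemma harmonic_space_one : harmonic_space 0 (cts_one : C).
Proof.
exists 1; split; first exact: mpoly.dhomog1.
  by rewrite /laplacian big1// => i _; rewrite -mpoly.mpolyC1 mpoly.mderivC raddf0.
by move=> y; rewrite /restrict_poly mpoly.meval1.
Qed.

Lemma msize_homogeneous l (p : mpoly.mpoly d.+1 R) :
  p \is mpoly.ishomog1 l mpoly.mdeg -> (mpoly.msize p <= l.+1)%N.
Proof.
move=> /mpoly.dhomogP hp; rewrite mpoly.msizeE; apply/bigmax_leqP_seq => m mp _.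
have -> : mpoly.mdeg m = l := hp m mp.
by rewrite leqnn.
Qed.

Lemma poly_space_mul l l' f g : harmonic_space l f -> harmonic_space l' g ->
  poly_space (l + l') (cts_mul f g).
Proof.
move=> [p [hp _ fp]] [q [hq _ gq]]; exists (p * q); last first.
  by move=> y; rewrite restrict_polyM -fp -gq.
exact: msize_homogeneous (mpoly.dhomogM hp hq).
Qed.

Lemma poly_space0 r : poly_space r (0 : C).
Proof. by exists 0 => [|y]; rewrite ?mpoly.msize0// restrict_poly0. Qed.

Lemma poly_spaceD r f g : poly_space r f -> poly_space r g ->
  poly_space r (f + g).
Proof.
move=> [p hp fp] [q hq gq]; exists (p + q) => [|y].
  by rewrite (leq_trans (mpoly.msizeD_le _ _))// geq_max hp.
by rewrite restrict_polyD -fp -gq.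
Qed.

Lemma poly_spaceZ r a f : poly_space r f -> poly_space r (a *: f).
Proof.
move=> [p hp fp]; exists (a *: p) => [|y].
  exact: leq_trans (mpoly.msizeZ_le _ _) hp.
by rewrite restrict_polyZ -fp.
Qed.

Lemma poly_space_harmonic r l f : (l <= r)%N -> harmonic_space l f ->
  poly_space r f.
Proof.
move=> lr [p [hp _ fp]]; exists p => //.
by apply: leq_trans (msize_homogeneous hp) _; rewrite ltnS.
Qed.

Lemma L2_dot_harmonic l l' f g : (2 <= d)%N -> l != l' ->
  harmonic_space l f -> harmonic_space l' g -> L2_dot f g = 0.
Proof.
move=> hd ll' [p [hp Lp fp]] [q [hq Lq gq]].
rewrite -(sphere_integral_harmonic hp Lp hq Lq hd ll').
by apply: eq_Rintegral => y _; rewrite restrict_polyM -fp -gq.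
Qed.

End spherical_functions.

Section discrete_products.
Context {R : realType} {d N : nat}.
Local Notation C := (continuousType (Sphere R d) R).
Variables (w : 'I_N -> R) (x : 'I_N -> Sphere R d).
Local Notation dot := (discrete_dot w x).
Implicit Types f g h : C.

Lemma discrete_dotC f g : dot f g = dot g f.
Proof. by apply: eq_bigr => j _; rewrite mulrAC. Qed.

Lemma discrete_dotDl f g h : dot (f + g) h = dot f h + dot g h.
Proof.
by rewrite /discrete_dot -big_split/=; apply: eq_bigr => j _;
  rewrite cts_addE; ring.
Qed.

Lemma discrete_dotZl a f h : dot (a *: f) h = a * dot f h.
Proof.
by rewrite /discrete_dot mulr_sumr; apply: eq_bigr => j _;
  rewrite cts_scaleE; ring.
Qed.

Lemma discrete_dot0l h : dot 0 h = 0.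
Proof. by rewrite -(scale0r 0) discrete_dotZl mul0r. Qed.

Lemma discrete_dotBl f g h : dot (f - g) h = dot f h - dot g h.
Proof. by rewrite discrete_dotDl -scaleN1r discrete_dotZl mulN1r. Qed.

Lemma discrete_dot_suml (I : finType) (F : I -> C) h :
  dot (\sum_i F i) h = \sum_i dot (F i) h.
Proof.
exact: (big_morph (dot^~ h) (fun f g => discrete_dotDl f g h)
  (discrete_dot0l h)).
Qed.

Lemma discrete_dot_exact f g r : quadrature_exactness w x r ->
  poly_space r (cts_mul f g) -> dot f g = L2_dot f g.
Proof.
move=> ex pfg; transitivity (quadrature w x (cts_mul f g)); last exact: ex.
by apply: eq_bigr => j _; rewrite -mulrA.
Qed.

End discrete_products.

Section thresholded_operators.
Context {R : realType} {d N : nat}.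
Local Notation C := (continuousType (Sphere R d) R).
Variables (w : 'I_N -> R) (x : 'I_N -> Sphere R d).
Variables (Z : nat -> nat) (Y : forall l, 'I_(Z l) -> C).
Local Notation dot := (discrete_dot w x).
Implicit Types (f g : C) (eta : R -> R).

Definition expansion m (c : forall l, 'I_(Z l) -> R) : C :=
  \sum_(l < m.+1) \sum_(k < Z l) c l k *: Y k.

Lemma eq_expansion m (c c' : forall l, 'I_(Z l) -> R) :
  (forall l (k : 'I_(Z l)), (l <= m)%N -> c l k = c' l k) ->
  expansion m c = expansion m c'.
Proof.
move=> cc'; apply: eq_bigr => l _; apply: eq_bigr => k _.
by rewrite cc'// -ltnS.
Qed.

Lemma expansion_minn m m' (c : forall l, 'I_(Z l) -> R) :
  expansion m (fun l k => if (l <= m')%N then c l k else 0) =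
  expansion (minn m m') c.
Proof.
rewrite /expansion (big_ord_widen m.+1
  (fun l => \sum_(k < Z l) c l k *: Y k)) ?ltnS ?geq_minl//.
rewrite [RHS]big_mkcond/=; apply: eq_bigr => l _.
rewrite ltnS leq_min leq_ord/=; case: ifP => _ //.
by rewrite big1// => k _; rewrite scale0r.
Qed.

(** Hyperinterpolation is the case [eta = id], and the hard thresholding
    operator is the case where [eta] is the threshold. *)
Definition thresholded eta m f : C :=
  expansion m (fun l k => eta (dot f (Y k))).

Lemma hyperinterpolationE m : hyperinterpolation w x Y m = thresholded id m.
Proof. by []. Qed.

Lemma hyperinterpolation_linear m : linear (hyperinterpolation w x Y m).
Proof.
move=> a f g; rewrite /hyperinterpolation scaler_sumr -big_split/=.
apply: eq_bigr => l _; rewrite scaler_sumr -big_split/=.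
by apply: eq_bigr => k _; rewrite discrete_dotDl discrete_dotZl scalerDl scalerA.
Qed.

Lemma dot_expansionl m (c : forall l, 'I_(Z l) -> R) g :
  dot (expansion m c) g =
  \sum_(l < m.+1) \sum_(k < Z l) c l k * dot g (Y k).
Proof.
rewrite discrete_dot_suml; apply: eq_bigr => l _.
rewrite discrete_dot_suml; apply: eq_bigr => k _.
by rewrite discrete_dotZl discrete_dotC.
Qed.

Variables (M : nat).
Hypothesis hd : (2 <= d)%N.
Hypothesis hY : forall l, orthonormal_basis (harmonic_space l) (@Y l).
Hypothesis hexact : quadrature_exactness w x (2 * M).

(** The product of two harmonics of degree at most [M] has degree at most
    [2 * M], where the quadrature rule is exact. *)
Lemma discrete_dot_harmonic l l' (j : 'I_(Z l)) (k : 'I_(Z l')) :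
  (l <= M)%N -> (l' <= M)%N -> dot (Y j) (Y k) = L2_dot (Y j) (Y k).
Proof.
move=> lM l'M; apply: discrete_dot_exact hexact _.
have [[Yl _ _] [Yl' _ _]] := (hY l, hY l').
have [p hp pE] := poly_space_mul (Yl j) (Yl' k).
by exists p => //; rewrite (leq_trans hp)// ltnS mul2n -addnn leq_add.
Qed.

(** The harmonics of degree at most [M] are orthonormal for the discrete
    product, so the discrete coefficients of an expansion are those that were
    put in. *)
Lemma coefficient_expansion m (c : forall l, 'I_(Z l) -> R) l (k : 'I_(Z l)) :
    (m <= M)%N -> (l <= M)%N ->
  dot (expansion m c) (Y k) = if (l <= m)%N then c l k else 0.
Proof.
move=> mM lM.
have off (l' : 'I_m.+1) : val l' != l ->
    \sum_(k' < Z l') c l' k' * dot (Y k) (Y k') = 0.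
  move=> l'l; apply: big1 => k' _; have l'M := leq_trans (leq_ord l') mM.
  rewrite discrete_dot_harmonic// (L2_dot_harmonic hd (l := l) (l' := l')).
  - by rewrite mulr0.
  - by rewrite eq_sym.
  - by have [+ _ _] := hY l; exact.
  - by have [+ _ _] := hY l'; exact.
rewrite dot_expansionl; case: leqP => lm; last first.
  by apply: big1 => l' _; apply: off; rewrite neq_ltn (leq_ltn_trans (leq_ord l') lm).
have lm1 : (l < m.+1)%N by [].
rewrite (bigD1 (Ordinal lm1))//= [X in _ + X]big1 ?addr0; last first.
  by move=> l' l'l; exact: off.
have [_ on _] := hY l.
rewrite (bigD1 k)//= discrete_dot_harmonic// on eqxx mulr1 big1 ?addr0// => k' kk'.
by rewrite discrete_dot_harmonic// on eq_sym (negbTE kk') mulr0.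
Qed.

(** The inner operator returns an expansion of degree [m'], whose discrete
    coefficients the outer one reads off unchanged, except that those of degree
    between [m'] and [m] are zero; [eta 0 = 0] keeps them so. *)
Lemma thresholded_comp eta eta' m m' : eta 0 = 0 -> (m <= M)%N -> (m' <= M)%N ->
  thresholded eta m \o thresholded eta' m' = thresholded (eta \o eta') (minn m m').
Proof.
move=> eta0 mM m'M; apply/funext => f /=.
rewrite /thresholded -expansion_minn; apply: eq_expansion => l k lm.
by rewrite coefficient_expansion ?(leq_trans lm mM)//; case: ifP.
Qed.

(** The hypothesis on [eta] says that each coefficient is kept or killed. It
    makes [thresholded eta m f] orthogonal to its difference with [f]. *)
Lemma thresholded_pythagoras eta m f : (m <= M)%N ->
    (forall a, eta a * eta a = eta a * a) ->
  dot (thresholded eta m f) (thresholded eta m f) +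
  dot (thresholded eta m f - f) (thresholded eta m f - f) = dot f f.
Proof.
move=> mM eta2; set g := thresholded eta m f.
have gg : dot g g = dot g f.
  rewrite [LHS]dot_expansionl [RHS]dot_expansionl.
  apply: eq_bigr => l _; apply: eq_bigr => k _.
  have lm : (l <= m)%N := leq_ord l.
  by rewrite coefficient_expansion ?(leq_trans lm mM)// lm eta2.
rewrite discrete_dotBl 2!(discrete_dotC _ _ _ (g - f)) !discrete_dotBl.
by rewrite gg (discrete_dotC _ _ f g); ring.
Qed.

Lemma poly_space_thresholded eta m f : (m <= M)%N ->
  poly_space M (thresholded eta m f).
Proof.
move=> mM; rewrite /thresholded /expansion.
elim/big_ind: _ => [|f1 f2|l _]; [exact: poly_space0|exact: poly_spaceD|].
elim/big_ind: _ => [|f1 f2|k _]; [exact: poly_space0|exact: poly_spaceD|].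
apply: poly_spaceZ; have [Yl _ _] := hY l.
exact: poly_space_harmonic (leq_trans (leq_ord l) mM) (Yl k).
Qed.

(** Constants are harmonics of degree [0], so there is a basis function of that
    degree, and its discrete coefficient [1] survives. *)
Lemma hyperinterpolation_neq0 m : (m <= M)%N ->
  hyperinterpolation w x Y m <> (fun=> 0).
Proof.
move=> mM L0; have [Y0 on span] := hY 0%N.
have [c oneE] := span _ harmonic_space_one.
have [k _] : exists k : 'I_(Z 0%N), True.
  case: (posnP (Z 0%N)) => [Z0|Z0]; last by exists (Ordinal Z0).
  have := congr1 (fun f : C => f point) oneE; rewrite big1 => [|k]; last first.
    by have := ltn_ord k; rewrite [X in (_ < X)%N]Z0.
  by move=> /eqP; rewrite cts_zeroE oner_eq0.
have := coefficient_expansion (fun l (j : 'I_(Z l)) => dot (Y k) (Y j)) k mM (leq0n M).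
rewrite leq0n -[expansion _ _]/(hyperinterpolation w x Y m (Y k)) L0.
rewrite discrete_dot0l discrete_dot_harmonic// on eqxx => /eqP.
by rewrite eq_sym oner_eq0.
Qed.

End thresholded_operators.

Lemma hard_threshold_id (R : realType) (lambda : R) a :
  hard_threshold (hard_threshold a lambda) lambda = hard_threshold a lambda.
Proof.
rewrite {2 3}/hard_threshold; case: ifP => al; first by rewrite /hard_threshold al.
by rewrite /hard_threshold; case: ifP.
Qed.

Theorem theorem5p2 (R : realType) (d : nat) (hd : (2 <= d)%N)
    (Z : nat -> nat)
    (Y : forall l : nat, 'I_(Z l) -> continuousType (Sphere R d) R)
    (hY : forall l : nat, orthonormal_basis (harmonic_space l) (Y l))
    (M : nat) (hM : (1 <= M)%N) (lambda : R) (hlambda : 0 < lambda)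
    (N : nat) (x : 'I_N -> Sphere R d) (w : 'I_N -> R)
    (hw : forall j : 'I_N, 0 < w j)
    (hexact : quadrature_exactness w x (2 * M))
    (n : nat) (hn : (1 <= n <= M)%N) :
  hyper_homomorphism w x (hyper_operators w x Y lambda M)
    (hyperinterpolation w x Y n).
Proof.
pose H a : R := hard_threshold a lambda.
have H0 : H 0 = 0 by rewrite /H /hard_threshold; case: ifP.
have HH : H \o H = H by apply/funext => a; exact: hard_threshold_id.
have H2 a : H a * H a = H a * a.
  by rewrite /H /hard_threshold; case: ifP; rewrite ?mul0r.
pose B := hyper_operators w x Y lambda M.
have BE T : B T <-> exists m (eta : R -> R),
    [/\ (1 <= m <= M)%N, eta = id \/ eta = H & T = thresholded w x Y eta m].
  split=> [[] [m mM <-]|[m [eta [mM [] -> ->]]]].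
  - by exists m, id; split => //; left.
  - by exists m, H; split => //; right.
  - by left; exists m.
  - by right; exists m.
have eta0 eta : eta = id \/ eta = H -> eta 0 = 0 by case=> ->.
have [n1 nM] := andP hn.
have Ln := hyperinterpolationE w x Y n.
split.
- split.
  + by exists M => T f /BE[m [eta [/andP[_ mM] _ ->]]]; exact: poly_space_thresholded.
  + move=> S T /BE[m [eta [/andP[m1 mM] e ->]]] /BE[m' [eta' [/andP[m'1 m'M] e' ->]]].
    apply/BE; exists (minn m m'), (eta \o eta'); split.
    * by rewrite leq_min m1 m'1 geq_min mM.
    * case: e => ->; case: e' => ->; [by left|by right|by right|].
      by right.
    * exact: (thresholded_comp hd hY hexact eta' (eta0 _ e) mM m'M).
  + move=> T f /BE[m [eta [/andP[_ mM] e ->]]].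
    apply: (thresholded_pythagoras hd hY hexact) => // a.
    by case: e => ->.
- exact: hyperinterpolation_linear.
- exists (hyperinterpolation w x Y n); first by left; exists n.
  rewrite Ln (thresholded_comp hd hY hexact)// minnn -hyperinterpolationE.
  exact: (hyperinterpolation_neq0 hd hY hexact).
- move=> S T /BE[m [eta [/andP[_ mM] e ->]]] /BE[m' [eta' [/andP[_ m'M] e' ->]]].
  have min_le a b : (a <= M)%N -> (minn a b <= M)%N by move=> aM; rewrite geq_min aM.
  rewrite Ln !(thresholded_comp hd hY hexact) ?(eta0 _ e)// ?min_le//;
    last exact: eta0.
  by congr thresholded; rewrite minnACA minnn.
Qed.
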